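(* For pre-doms, the following four axioms (universally quantified over $x,y$) are independent, i.e. for each of them there is a pre-dom satisfying the other three but not that one: (MA) $-0\leq 0$; (MB) $|x|\geq 0$; (MCa) if $x<y$ then $x-y<0$; (MCb) if $x-y<0$ then $x<y$.
   Context: A pre-dom is a structure $(M,\leq,0,+,-)$ where $(M,+,0)$ is a commutative monoid with neutral element $0$, $\leq$ is a linear order with $z\leq z'\Rightarrow z+t\leq z'+t$, and the unary $-$ is an order-reversing bijection of $M$ with $-(-x)=x$ (neither $-0=0$ nor $x+(-x)=0$ is assumed). The binary minus is $x-y:=-((-x)+y)$, and $|x|:=\max(x,-x)$. *)

(* Defs.v *)
(* Written with MathComp. *)
From HB Require Import structures.
From mathcomp Require Import all_boot all_order.

Set Implicit Arguments.
Unset Strict Implicit.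
Unset Printing Implicit Defensive.

Import Order.TTheory.
Local Open Scope order_scope.

(* Hierarchy-Builder refuses a new join of an order with [nmodType] above the
   existing [porderZmodType], hence the commutative monoid law is part of the
   mixin. That the unary minus is a bijection is not a separate field, since it
   is a consequence of the involution law (see [pdopp_bij]). *)
HB.mixin Record isPreDom (d : Order.disp_t) M of Order.Total d M := {
  pdzero : M;
  pdadd : M -> M -> M;
  pdopp : M -> M;
  pdaddA : associative pdadd;
  pdaddC : commutative pdadd;
  pdadd0 : left_id pdzero pdadd;
  pdadd_le : forall z z' t : M, z <= z' -> pdadd z t <= pdadd z' t;
  pdopp_anti : forall x y : M, x <= y -> pdopp y <= pdopp x;
  pdoppK : forall x : M, pdopp (pdopp x) = x
}.

#[short(type="preDomType")]
HB.structure Definition PreDom (d : Order.disp_t) :=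
  { M of isPreDom d M & Order.Total d M }.

Declare Scope predom_scope.
Delimit Scope predom_scope with PD.
Local Open Scope predom_scope.

Notation "0" := pdzero : predom_scope.
Notation "x + y" := (pdadd x y) : predom_scope.
Notation "- x" := (pdopp x) : predom_scope.

Lemma pdopp_bij (d : Order.disp_t) (M : preDomType d) :
  bijective (fun x : M => - x).
Proof. exact: inv_bij pdoppK. Qed.

Section PreDomDefs.

Variables (d : Order.disp_t) (M : preDomType d).

Definition pdsub (x y : M) : M := - (- x + y).

Definition pdabs (x : M) : M := Order.max x (- x).

Definition MA : Prop := (- 0 : M) <= 0.

Definition MB : Prop := forall x : M, pdabs x >= 0.

Definition MCa : Prop := forall x y : M, x < y -> pdsub x y < 0.

Definition MCb : Prop := forall x y : M, pdsub x y < 0 -> x < y.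

End PreDomDefs.

Arguments MA {d} M.
Arguments MB {d} M.
Arguments MCa {d} M.
Arguments MCb {d} M.

(* Main.v *)
(** All four pre-doms live on the ordered set of integers, with neutral element
    0 and minus the reflection [x |-> c - x]. Under the usual addition,
    [x - y < 0] unfolds to [c < (c - x) + y], i.e. to [x < y], so (MCa) and (MCb)
    hold for every [c]; then [c = 1] violates (MA) and [c = -2] violates (MB), at
    [x = -1]. For the other two axioms the addition is idempotent: [min] or [max]
    according to the signs of the arguments. If the negative sign wins, then
    [c = -1] violates (MCa), since 0 - 1 = 0; if the positive sign wins, then
    [c = 0] violates (MCb), since 1 - 1 = -1. *)
Require Import Defs.
From HB Require Import structures.
From mathcomp Require Import all_boot all_order.
From mathcomp Require Import ssralg ssrnum ssrint zify.

Set Implicit Arguments.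
Unset Strict Implicit.
Unset Printing Implicit Defensive.

Import GRing.Theory.
Local Open Scope ring_scope.

Definition reflection (c x : int) : int := c - x.

Lemma reflection_anti (c x y : int) :
  x <= y -> reflection c y <= reflection c x.
Proof. rewrite /reflection; lia. Qed.

Lemma reflectionK (c : int) : involutive (reflection c).
Proof. exact: subKr. Qed.

(** The index [c] in the type lets instance inference find a different minus for each [c]. *)
Definition reflected_int (c : int) : Type := int.

HB.instance Definition _ (c : int) := Order.Total.on (reflected_int c).

Lemma addz_le (z z' t : int) : z <= z' -> z + t <= z' + t.
Proof. lia. Qed.

HB.instance Definition _ (c : int) :=
  @isPreDom.Build _ (reflected_int c) 0 +%R (reflection c)
    (@addrA int) (@addrC int) (@add0r int) addz_le
    (@reflection_anti c) (@reflectionK c).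

(** Innermost conditions are split first, so none still contains a conditional when it reaches
    [lia]. *)
Ltac lia_if :=
  repeat match goal with
  | |- context [if ?b then _ else _] =>
    lazymatch b with
    | context [if _ then _ else _] => fail
    | _ => case: (boolP b) => ?
    end
  end; lia.

Definition neg_wins (x y : int) : int :=
  if (0 <= x) && (0 <= y) then Order.max x y else Order.min x y.

(** Either bracketing gives the minimum of the three arguments if one of them is negative, and their
    maximum otherwise. *)
Lemma neg_winsA : associative neg_wins.
Proof. rewrite /neg_wins => x y z; lia_if. Qed.

Lemma neg_winsC : commutative neg_wins.
Proof. rewrite /neg_wins => x y; lia_if. Qed.

Lemma neg_wins0 : left_id 0 neg_wins.
Proof. rewrite /neg_wins => x; lia_if. Qed.

Lemma neg_wins_le (z z' t : int) : z <= z' -> neg_wins z t <= neg_wins z' t.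
Proof. rewrite /neg_wins; lia_if. Qed.

Definition neg_wins_int : Type := int.

HB.instance Definition _ := Order.Total.on neg_wins_int.

HB.instance Definition _ :=
  @isPreDom.Build _ neg_wins_int 0 neg_wins (reflection (-1))
    neg_winsA neg_winsC neg_wins0 neg_wins_le
    (@reflection_anti (-1)) (@reflectionK (-1)).

(** The conjugate of [neg_wins] under the integer negation. *)
Definition pos_wins (x y : int) : int :=
  if (x <= 0) && (y <= 0) then Order.min x y else Order.max x y.

Lemma pos_winsA : associative pos_wins.
Proof. rewrite /pos_wins => x y z; lia_if. Qed.

Lemma pos_winsC : commutative pos_wins.
Proof. rewrite /pos_wins => x y; lia_if. Qed.

Lemma pos_wins0 : left_id 0 pos_wins.
Proof. rewrite /pos_wins => x; lia_if. Qed.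

Lemma pos_wins_le (z z' t : int) : z <= z' -> pos_wins z t <= pos_wins z' t.
Proof. rewrite /pos_wins; lia_if. Qed.

Definition pos_wins_int : Type := int.

HB.instance Definition _ := Order.Total.on pos_wins_int.

HB.instance Definition _ :=
  @isPreDom.Build _ pos_wins_int 0 pos_wins (reflection 0)
    pos_winsA pos_winsC pos_wins0 pos_wins_le
    (@reflection_anti 0) (@reflectionK 0).

Lemma reflected_MA (c : int) : MA (reflected_int c) <-> c <= 0.
Proof.
change (reflection c 0 <= 0 <-> c <= 0).
rewrite /reflection; lia.
Qed.

(** Only negative [x] matter; there [c - x] is least at [x = -1], with value [c + 1]. *)
Lemma reflected_MB (c : int) : MB (reflected_int c) <-> -1 <= c.
Proof.
change ((forall x : int, 0 <= Order.max x (reflection c x)) <-> -1 <= c).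
rewrite /reflection; split=> [/(_ (-1)) | c_ge x]; lia.
Qed.

Lemma reflected_MCa (c : int) : MCa (reflected_int c).
Proof.
change (forall x y : int, x < y -> reflection c (reflection c x + y) < 0).
rewrite /reflection; lia.
Qed.

Lemma reflected_MCb (c : int) : MCb (reflected_int c).
Proof.
change (forall x y : int, reflection c (reflection c x + y) < 0 -> x < y).
rewrite /reflection; lia.
Qed.

Lemma neg_wins_MA : MA neg_wins_int.
Proof. by []. Qed.

Lemma neg_wins_MB : MB neg_wins_int.
Proof.
change (forall x : int, 0 <= Order.max x (reflection (-1) x)).
rewrite /reflection; lia.
Qed.

Lemma neg_wins_not_MCa : ~ MCa neg_wins_int.
Proof. by move=> /(_ (0 : int) (1 : int) isT). Qed.

(** A negative difference means that [neg_wins (-1 - x) y] is nonnegative, which forces both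
    arguments to be so: [x <= -1] and [0 <= y]. *)
Lemma neg_wins_MCb : MCb neg_wins_int.
Proof.
change (forall x y : int,
  reflection (-1) (neg_wins (reflection (-1) x) y) < 0 -> x < y).
rewrite /reflection /neg_wins => x y; lia_if.
Qed.

Lemma pos_wins_MA : MA pos_wins_int.
Proof. by []. Qed.

Lemma pos_wins_MB : MB pos_wins_int.
Proof.
change (forall x : int, 0 <= Order.max x (reflection 0 x)).
rewrite /reflection; lia.
Qed.

(** The difference is negative as soon as [x < 0] or [0 < y]; if both fail, then [y <= 0 <= x]. *)
Lemma pos_wins_MCa : MCa pos_wins_int.
Proof.
change (forall x y : int,
  x < y -> reflection 0 (pos_wins (reflection 0 x) y) < 0).
rewrite /reflection /pos_wins => x y; lia_if.
Qed.

Lemma pos_wins_not_MCb : ~ MCb pos_wins_int.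
Proof. by move=> /(_ (1 : int) (1 : int) isT). Qed.

Theorem mainTheorem19 :
  (exists (d : Order.disp_t) (M : preDomType d),
     ~ MA M /\ MB M /\ MCa M /\ MCb M) /\
  (exists (d : Order.disp_t) (M : preDomType d),
     MA M /\ ~ MB M /\ MCa M /\ MCb M) /\
  (exists (d : Order.disp_t) (M : preDomType d),
     MA M /\ MB M /\ ~ MCa M /\ MCb M) /\
  (exists (d : Order.disp_t) (M : preDomType d),
     MA M /\ MB M /\ MCa M /\ ~ MCb M).
Proof.
(* The order display stays open until the witness for [M] determines it. *)
split; [|split; [|split]]; eexists.
- exists (reflected_int 1); rewrite reflected_MA reflected_MB.
  by split=> //; split=> //; split; [exact: reflected_MCa | exact: reflected_MCb].
- exists (reflected_int (-2)); rewrite reflected_MA reflected_MB.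
  by split=> //; split=> //; split; [exact: reflected_MCa | exact: reflected_MCb].
- exists neg_wins_int; split; first exact: neg_wins_MA.
  split; first exact: neg_wins_MB.
  by split; [exact: neg_wins_not_MCa | exact: neg_wins_MCb].
- exists pos_wins_int; split; first exact: pos_wins_MA.
  split; first exact: pos_wins_MB.
  by split; [exact: pos_wins_MCa | exact: pos_wins_not_MCb].
Qed.
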